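(* Let $\{\mathbf{Y}\cup\{\Delta\},\mathbf{A},p\}$ be an MDP model (as described in the context) with $\mathbf{X}=\mathbf{Y}\cup\{\Delta\}$, satisfying Condition (S), and let $F$ be a nonempty finite subset of $\mathbf{X}$ such that the model is uniformly absorbing with initial state $x$ for each $x\in F$ (so that $\mathcal{D}^\Pi_F\subseteq\mathcal{M}(\mathbf{Y}\times\mathbf{A})$). Then the w-topology and the ws-topology on $\mathcal{D}^\Pi_F$ coincide.
   Context: An MDP model $\{\mathbf{X},\mathbf{A},p\}$ consists of nonempty topological Borel spaces $\mathbf{X}$ (states) and $\mathbf{A}$ (actions) with their Borel $\sigma$-algebras, and a stochastic kernel $p(dy|x,a)$ on $\mathcal{B}(\mathbf{X})$ given $\mathbf{X}\times\mathbf{A}$. Let $\mathbf{H}_0=\mathbf{X}$, $\mathbf{H}_n=(\mathbf{X}\times\mathbf{A})^n\times\mathbf{X}$, $\mathbf{H}=\mathbf{X}\times(\mathbf{A}\times\mathbf{X})^\infty$, $X_n(h)=x_n$, $A_{n+1}(h)=a_{n+1}$. A strategy is a sequence $\pi=\{\pi_n\}_{n\ge1}$ of stochastic kernels $\pi_n(da|h_{n-1})$ on $\mathcal{B}(\mathbf{A})$ given $\mathbf{H}_{n-1}$; $\Pi$ is the set of all strategies. For an initial state $x$ and $\pi\in\Pi$, $\mathbb{P}^\pi_{x}$ is the unique probability on $\mathbf{H}$ with $X_0=x$, conditional law of $A_{n+1}$ given $X_0,A_1,\dots,X_n$ equal to $\pi_{n+1}(\cdot|X_0,A_1,\dots,X_n)$,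 and conditional law of $X_{n+1}$ given $X_0,\dots,X_n,A_{n+1}$ equal to $p(\cdot|X_n,A_{n+1})$; $\mathbb{E}^\pi_{x}$ is its expectation. The model $\{\mathbf{Y}\cup\{\Delta\},\mathbf{A},p\}$ has $\mathbf{X}=\mathbf{Y}\cup\{\Delta\}$ with $\mathbf{Y}$ a Borel space, $\Delta$ an isolated point, and $p(\{\Delta\}|\Delta,a)=1$ for all $a$. Let $\tau=\inf\{n\ge0:X_n=\Delta\}$. The model is absorbing with initial state $x$ if $\mathbb{E}^\pi_x[\tau]<\infty$ for all $\pi\in\Pi$, and uniformly absorbing with initial state $x$ if in addition $\lim_{n\to\infty}\sup_{\pi\in\Pi}\mathbb{E}^\pi_{x}[\sum_{t=n}^\infty\mathbb{I}\{\tau>t\}]=0$. The occupation measure of $\pi$ with initial state $x$ is $\eta^\pi_{x}(dy\times da)=\mathbb{E}^\pi_{x}[\sum_{n=0}^\infty\mathbb{I}\{X_n\in dy,A_{n+1}\in da\}]$ on $\mathbf{Y}\times\mathbf{A}$, and $\mathcal{D}^\Pi_F=\{\eta^\pi_x:x\in F,\pi\in\Pi\}$. Condition (S): $\mathbf{A}$ is compact and for each bounded measurable $g$ on $\mathbf{X}$ and each $x\in\mathbf{X}$, $a\mapsto\int_{\mathbf{X}}g(y)p(dy|x,a)$ is continuous. On the space $\mathcal{M}(\mathbf{Y}\times\mathbf{A})$ of finite Borel measures: the w-topology is the coarsest topology making $\eta\mapsto\int g\,d\eta$ continuous for all bounded continuous $g$; the ws-topology is the coarsest topology making $\eta\mapsto\int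 g\,d\eta$ continuous for all bounded Carathéodory functions $g$, i.e. real measurable functions $g(y,a)$ continuous in $a$ for each fixed $y\in\mathbf{Y}$. Topologies on $\mathcal{D}^\Pi_F$ are the relative ones. *)

(* Defs.v *)
From HB Require Import structures.
From mathcomp Require Import all_boot all_order all_algebra.
From mathcomp Require Import all_classical all_reals all_analysis measurable_realfun.

Set Implicit Arguments.
Unset Strict Implicit.
Unset Printing Implicit Defensive.
Import Order.TTheory GRing.Theory Num.Theory.
Import numFieldNormedType.Exports.
Local Open Scope classical_set_scope.
Local Open Scope ring_scope.

Definition borel (T : ptopologicalType) : Type := T.

Section borel_instance.
Context (T : ptopologicalType).
HB.instance Definition _ := Pointed.on (borel T).
HB.instance Definition _ := Topological.on (borel T).

Lemma borel_meas0 : <<s @open T >> (set0 : set T).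
Proof. exact: (@sigma_algebra0 _ setT (@open T)). Qed.

Lemma borel_measC (B : set T) : <<s @open T >> B -> <<s @open T >> (~` B).
Proof.
by move=> sB; rewrite -setTD; exact: (@sigma_algebraCD _ setT (@open T)).
Qed.

Lemma borel_measU (F : (set T)^nat) :
  (forall i, <<s @open T >> (F i)) -> <<s @open T >> (\bigcup_i F i).
Proof. exact: (@sigma_algebra_bigcup _ setT (@open T)). Qed.

HB.instance Definition _ := @isMeasurable.Build (sigma_display (@open T))
  (borel T) <<s @open T >> borel_meas0 borel_measC borel_measU.
End borel_instance.

Definition is_Borel_space (R : realType) (T : topologicalType) (S : set T) : Prop :=
  exists (P : completePseudoMetricType R) (B : set P) (f : T -> P),
    hausdorff_space P /\
    (exists D : set P, countable D /\ closure D = setT) /\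
    <<s @open P >> B /\
    set_inj S f /\ f @` S = B /\
    {within S, continuous f} /\
    (forall U : set T, open U ->
       exists V : set P, open V /\ f @` (U `&` S) = V `&` B).

(* Histories.  A history h : nat -> X * A encodes                     *)
(*   h n = (x_n, a_{n+1}),  i.e.  X_n(h) = (h n).1, A_{n+1}(h) = (h n).2 *)
Section MDP.
Context (R : realType) (X A : ptopologicalType).
Local Notation XB := (borel X).
Local Notation AB := (borel A).

Definition hist0 := nat -> (XB * AB)%type.

Definition cyl_all : set (set hist0) :=
  fun S => exists i (B : set (XB * AB)%type), measurable B /\
    S = (fun h : hist0 => h i) @^-1` B.

Definition hist := g_sigma_algebraType cyl_all.

(* generators of sigma(X_0, A_1, ..., A_n, X_n) (history h_n) *)
Definition G_hist (n : nat) : set (set hist) :=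
  fun S => (exists i (B : set (XB * AB)%type), (i < n)%N /\ measurable B /\
              S = (fun h : hist => h i) @^-1` B)
        \/ (exists C : set XB, measurable C /\
              S = (fun h : hist => (h n).1) @^-1` C).

(* generators of sigma(X_0, A_1, ..., X_n, A_{n+1}) *)
Definition G_hista (n : nat) : set (set hist) :=
  fun S => exists i (B : set (XB * AB)%type), (i <= n)%N /\ measurable B /\
              S = (fun h : hist => h i) @^-1` B.

Definition G_measurable (G : set (set hist)) (f : hist -> \bar R) : Prop :=
  @measurable_fun _ _ (g_sigma_algebraType G) _ setT f.

(* a strategy: pi n h = pi_{n+1}( . | h_n), a stochastic kernel on A
   given H_n (i.e. measurable w.r.t. the sigma-algebra of h_n) *)
Definition strategy := nat -> hist -> probability AB R.

Definition is_strategy (pi : strategy) : Prop :=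
  forall n (C : set AB), measurable C -> G_measurable (G_hist n) (fun h => pi n h C).

Definition is_kernel (p : (XB * AB)%type -> probability XB R) : Prop :=
  forall C : set XB, measurable C -> measurable_fun setT (fun z => p z C).

Definition is_strategic_measure (p : (XB * AB)%type -> probability XB R)
    (x : X) (pi : strategy) (P : probability hist R) : Prop :=
  [/\ P [set h : hist | (h 0%N).1 = x] = 1%E,
      (forall n (B : set hist) (C : set AB), <<s G_hist n >> B -> measurable C ->
         P (B `&` [set h | C (h n).2]) = (\int[P]_(h in B) pi n h C)%E) &
      (forall n (B : set hist) (C : set XB), <<s G_hista n >> B -> measurable C ->
         P (B `&` [set h | C (h n.+1).1]) = (\int[P]_(h in B) p (h n) C)%E)].

Definition condition_S (p : (XB * AB)%type -> probability XB R) : Prop :=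
  compact (setT : set A) /\
  forall g : XB -> R, measurable_fun setT g -> (exists M, forall y, `|g y| <= M) ->
  forall x : XB, continuous (fun a : AB => fine (\int[p (x, a)]_y (g y)%:E)).

Definition tau (Delta : X) (h : hist) : \bar R :=
  ereal_inf [set (n%:R)%:E | n in [set n | (h n).1 = Delta]].

Definition tail_time (Delta : X) (P : probability hist R) (n : nat) : \bar R :=
  \int[P]_h (\sum_(n <= t <oo) (((t%:R)%:E < tau Delta h)%E)%:R%:E).

Definition uniformly_absorbing (Delta : X)
    (Pm : X -> strategy -> probability hist R) (x : X) : Prop :=
  (forall pi, is_strategy pi -> (\int[Pm x pi]_h tau Delta h < +oo)%E) /\
  ((fun n => ereal_sup [set tail_time Delta (Pm x pi) n | pi in is_strategy])
     @ \oo --> 0%E).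

Definition YA (Delta : X) : set (XB * AB)%type := [set z | z.1 <> Delta].

(* occupation measure, as a set function on B(X x A) concentrated on Y x A:
   eta(D) = E[ sum_n I{ (X_n, A_{n+1}) in D, X_n in Y } ] *)
Definition occupation (Delta : X) (P : probability hist R) :
    set (XB * AB)%type -> \bar R :=
  fun D => (\int[P]_h (\sum_(0 <= n <oo) (\1_(D `&` YA Delta) (h n))%:E))%E.

Definition occ_set (Delta : X) (Pm : X -> strategy -> probability hist R)
    (F : set X) : set (set (XB * AB)%type -> \bar R) :=
  fun eta => exists x pi, [/\ F x, is_strategy pi & eta = occupation Delta (Pm x pi)].

Definition bounded_continuous_YA (Delta : X) (g : (XB * AB)%type -> R) : Prop :=
  (exists M, forall z, YA Delta z -> `|g z| <= M) /\ {within YA Delta, continuous g}.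

Definition bounded_caratheodory_YA (Delta : X) (g : (XB * AB)%type -> R) : Prop :=
  [/\ (exists M, forall z, YA Delta z -> `|g z| <= M),
      measurable_fun (YA Delta) g &
      forall y : XB, y <> Delta -> continuous (fun a : AB => g (y, a))].

Definition integ_YA (Delta : X) (g : (XB * AB)%type -> R)
    (eta : set (XB * AB)%type -> \bar R) : R :=
  fine (\int[eta]_(z in YA Delta) (g z)%:E).

End MDP.

Definition is_topology_on {T} (S : set T) (O : set (set T)) : Prop :=
  [/\ O S,
      (forall Fam : set (set T), Fam `<=` O -> O (\bigcup_(U in Fam) U)) &
      (forall U V, O U -> O V -> O (U `&` V))].

Definition generated_topology {T} (S : set T) (subb : set (set T)) : set (set T) :=
  fun U => forall O, is_topology_on S O -> subb `<=` O -> O U.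

Definition initial_topology_on {R : realType} {T} (D : set T) (maps : set (T -> R))
  : set (set T) :=
  generated_topology D
    (fun U => exists phi (V : set R), maps phi /\ open V /\
       U = [set t | D t /\ V (phi t)]).

Definition w_topology (R : realType) (X A : ptopologicalType) (Delta : X)
    (Pm : X -> strategy R X A -> probability (hist X A) R) (F : set X) :=
  initial_topology_on (occ_set Delta Pm F)
    (fun phi => exists g, bounded_continuous_YA Delta g /\ phi = integ_YA Delta g).

Definition ws_topology (R : realType) (X A : ptopologicalType) (Delta : X)
    (Pm : X -> strategy R X A -> probability (hist X A) R) (F : set X) :=
  initial_topology_on (occ_set Delta Pm F)
    (fun phi => exists g, bounded_caratheodory_YA Delta g /\ phi = integ_YA Delta g).

(* Main.v *)
Require Import Defs.
From HB Require Import structures.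
From mathcomp Require Import all_boot all_order all_algebra ring lra.
From mathcomp Require Import all_classical all_reals all_analysis measurable_realfun.
Set Implicit Arguments.
Unset Strict Implicit.
Unset Printing Implicit Defensive.
Import Order.TTheory GRing.Theory Num.Theory.
Import numFieldNormedType.Exports.
Local Open Scope classical_set_scope.
Local Open Scope ring_scope.

(** Put [nu B := sup eta (B `*` A)] over all occupation measures [eta] started
    in [F].  The theorem rests on [nu (B n) -> 0] whenever every state lies in
    only finitely many [B n].  Indeed [P (X_t \in B) <= (T^t 1_B) x], where
    [T f x] is the supremum over [a] of the integral of [f] against
    [p (x, a)]; by Dini's theorem on the compact [A], Condition (S) makes [T]
    preserve sequences decreasing pointwise to [0], and uniform absorption
    controls the contribution of large [t].

    Hence the functions of the state that are, off sets of small [nu], uniformly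
    close to bounded continuous functions are closed under pointwise limits, so
    they include all measurable ones.  A Caratheodory function [g] is close
    to the interpolation [sum_c g (y, c) * phi_c a] along a fine partition of
    unity [phi] of [A], off a set of small [nu]; replacing each [g (., c)] by a
    continuous function yields a continuous [G] with [int |g - G| d eta] small
    uniformly in [eta].  So the maps defining the ws-topology are uniform limits
    of maps defining the w-topology. *)

(** * Interpolation on compact metrizable spaces *)

(** Together the two conditions say that the topology of [T] is the one pulled back along [e] from
    the pseudometric of [P]. *)
Definition metric_embedding (R : realType) (T : topologicalType)
    (P : pseudoMetricType R) (e : T -> P) :=
  continuous e /\ forall (x : T) (U : set T), nbhs x U ->
    exists2 r : R, 0 < r & forall y, ball (e x) r (e y) -> U y.

Lemma Borel_space_embedding (R : realType) (T : topologicalType) :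
  is_Borel_space R (setT : set T) ->
  exists (P : pseudoMetricType R) (e : T -> P), metric_embedding e.
Proof.
move=> [P [B [e [_ [_ [_ [einj [eB [ce oe]]]]]]]]].
exists P, e; split; first exact/continuous_subspace_setT.
move=> x U; rewrite nbhsE => -[U' [oU' U'x] U'U].
have [V [oV]] := oe _ oU'; rewrite setIT => eV.
have /(_ (e x)) : e @` U' `<=` V `&` B by rewrite eV.
case; first by exists x.
move=> Vex _.
have /nbhs_ballP[r /= r0 rV] : nbhs (e x) V by exact: open_nbhs_nbhs.
exists r => // y /rV Vy; apply: U'U.
have : (V `&` B) (e y) by split => //; rewrite -eB; exists y.
by rewrite -eV => -[z U'z /einj <- //]; rewrite in_setT.
Qed.

(** The entourage of pairs at distance less than [r] separates the images of [A] and [B] uniformly,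
    so a Urysohn function on [P] can be pulled back along [e]. *)
Lemma continuous_separation (R : realType) (T : topologicalType)
    (P : pseudoMetricType R) (e : T -> P) (A B : set T) (r : R) :
  continuous e -> 0 < r -> (forall a b, A a -> B b -> ~ ball (e a) r (e b)) ->
  exists f : T -> R, [/\ continuous f, forall x, 0 <= f x <= 1,
    forall x, A x -> f x = 0 & forall x, B x -> f x = 1].
Proof.
move=> ce r0 AB.
have sep : uniform_separator (e @` A) (e @` B).
  apply: uniform_separatorW; exists [set xy | ball xy.1 r xy.2].
    exact: entourage_ball (PosNum r0).
  apply/seteqP; split => // -[_ _] [[/= [a Aa <-] [b Bb <-]]] /=.
  exact: AB.
exists (Urysohn (e @` A) (e @` B) \o e); split.
- by move=> x; apply: continuous_comp; [exact: ce|exact: Urysohn_continuous].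
- move=> x /=; have /= := @Urysohn_range P R (e @` A) (e @` B) (Urysohn (e @` A) (e @` B) (e x)).
  by rewrite in_itv/=; apply; exists (e x).
- by move=> x Ax; apply: (Urysohn_sub0 sep); exists (e x) => //; exists x.
- by move=> x Bx; apply: (Urysohn_sub1 sep); exists (e x) => //; exists x.
Qed.

Lemma open_indic_continuous_limit (R : realType) (T : topologicalType)
    (P : pseudoMetricType R) (e : T -> P) (U : set T) :
  metric_embedding e -> open U ->
  exists f : nat -> T -> R, [/\ forall k, continuous (f k),
    forall k x, 0 <= f k x <= 1 & forall x, \forall k \near \oo, f k x = \1_U x].
Proof.
move=> [ce eU] oU.
(* [f k] is [0] off [U] and [1] at the points whose [e]-ball of radius [1/(k+1)] stays in [U]; these
   points exhaust [U] as [k] grows. *)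
have /choice[f fP] : forall k : nat, exists f : T -> R,
    [/\ continuous f, forall x, 0 <= f x <= 1, forall x, ~ U x -> f x = 0 &
      forall x, (forall y, ball (e x) k.+1%:R^-1 (e y) -> U y) -> f x = 1].
  move=> k; apply: (@continuous_separation R T P e (~` U) _ k.+1%:R^-1) => //.
  by move=> a b nUa bU ab; apply/nUa/bU/ball_sym.
exists f; split=> [k|k|x]; [by have [] := fP k|by have [] := fP k|].
have [Ux|nUx] := pselect (U x); last first.
  apply: nearW => k; have [_ _ -> // _] := fP k.
  by rewrite indicE memNset.
have [r r0 rU] := eU x U (open_nbhs_nbhs (conj oU Ux)).
near=> k; have [_ _ _ ->] := fP k; first by rewrite indicE mem_set.
move=> y kxy; apply: rU; apply: le_ball kxy; apply: ltW.
by near: k; exact: near_infty_natSinv_lt (PosNum r0).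
Unshelve. all: by end_near. Qed.

Lemma continuous_sum (R : realType) (T : topologicalType) (I : Type) (s : seq I)
    (f : I -> T -> R) :
  (forall i, continuous (f i)) -> continuous (fun x => \sum_(i <- s) f i x).
Proof.
move=> cf; elim: s => [|i s IH] x.
  by under eq_fun do rewrite big_nil; exact: cvg_cst.
by under eq_fun do rewrite big_cons; apply: cvgD; [exact: cf|exact: IH].
Qed.

(** Bumps equal to [1] on half-balls and [0] off the full balls: finitely many half-balls cover [T],
    so the sum of their bumps is positive and can be divided out. *)
Lemma compact_partition_of_unity (R : realType) (T : ptopologicalType)
    (P : pseudoMetricType R) (e : T -> P) (r : R) :
  continuous e -> compact [set: T] -> 0 < r ->
  exists (s : seq T) (phi : T -> T -> R), [/\ forall c, continuous (phi c),
    forall c a, 0 <= phi c a, forall a, \sum_(c <- s) phi c a = 1 &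
    forall c a, phi c a != 0 -> ball (e c) r (e a)].
Proof.
move=> ce cT r0; have r20 : 0 < r / 2 by rewrite divr_gt0.
have /choice[psi psiP] : forall c, exists f : T -> R,
    [/\ continuous f, forall x, 0 <= f x <= 1,
      forall x, ~ ball (e c) r (e x) -> f x = 0 &
      forall x, ball (e c) (r / 2) (e x) -> f x = 1].
  move=> c.
  apply: (@continuous_separation R T P e [set x | ~ ball (e c) r (e x)] _ (r / 2)) => //.
  move=> a b /= nca cb ab; apply: nca; rewrite (splitr r).
  exact: ball_triangle cb (ball_sym ab).
move: cT; rewrite compact_cover => /(_ T setT (fun c => e @^-1` (ball (e c) (r / 2))^°)).
case.
- move=> c _; apply: open_comp; last exact: open_interior.
  by move=> x _; exact: ce.
- move=> a _; exists a => //=; apply: nbhsx_ballx => //.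
move=> D' _ Dcov; pose S a := \sum_(c <- finmap.enum_fset D') psi c a.
have psi0 c a : 0 <= psi c a by have [_ /(_ a)/andP[]] := psiP c.
have S0 a : 0 < S a.
  have [c /= cD /interior_subset/= ca] := Dcov a I.
  rewrite /S (big_rem c)//=; have [_ _ _ -> //] := psiP c.
  by rewrite ltr_wpDr// sumr_ge0.
have cS : continuous S by apply: continuous_sum => c; have [] := psiP c.
exists (finmap.enum_fset D'), (fun c a => psi c a / S a); split.
- move=> c a; apply: cvgM; first by have [+ _ _ _] := psiP c; exact.
  by apply: cvgV; [exact/lt0r_neq0/S0|exact: cS].
- by move=> c a; rewrite divr_ge0// ltW.
- move=> a; rewrite -mulr_suml; apply: divff; exact/lt0r_neq0/S0.
- move=> c a; rewrite mulf_eq0 negb_or => /andP[+ _]; apply: contraPP => cNa.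
  by have [_ _ -> // _] := psiP c; rewrite eqxx.
Qed.

(** The error at [a] is an average of [f a - f c] over nodes [c] within [1/(k+1)] of [a], so uniform
    continuity of [f] makes it small. Nodes and weights are fixed before [f], which lets one scheme
    serve all sections [g (y, .)] at once. *)
Lemma compact_interpolation (R : realType) (T : ptopologicalType)
    (P : pseudoMetricType R) (e : T -> P) :
  metric_embedding e -> compact [set: T] ->
  exists (s : nat -> seq T) (phi : nat -> T -> T -> R), [/\
    forall k c, continuous (phi k c), forall k c a, 0 <= phi k c a,
    forall k a, \sum_(c <- s k) phi k c a = 1 &
    forall f : T -> R, continuous f -> forall eps : R, 0 < eps ->
      \forall k \near \oo, forall a,
        `|f a - \sum_(c <- s k) f c * phi k c a| <= eps].
Proof.
move=> [ce eU] cT.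
have /choice[s /choice[phi sphi]] := fun k : nat =>
  @compact_partition_of_unity R T P e k.+1%:R^-1 ce cT ltac:(by []).
exists s, phi; split=> [k c|k c a|k a|f cf eps eps0].
- by have [] := sphi k.
- by have [] := sphi k.
- by have [] := sphi k.
have /compact_near_coveringP ncT := cT.
(* Uniform continuity of [f] for the pulled-back pseudometric, obtained from compactness. *)
have osc : \forall k \near \oo, [set: T] `<=`
    [set a | forall b, ball (e a) k.+1%:R^-1 (e b) -> `|f a - f b| <= eps].
  apply: ncT => a _.
  have e20 : 0 < eps / 2 by rewrite divr_gt0.
  have /cvgrPdist_lt/(_ _ e20) fa := cf a.
  have [r r0 rf] := eU a _ fa.
  have r20 : 0 < r / 2 by rewrite divr_gt0.
  near=> a' k => /= b a'b.
  have aa' : ball (e a) (r / 2) (e a').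
    near: a'; apply: (ce a); exact: nbhsx_ballx.
  have ab : ball (e a) r (e b).
    rewrite (splitr r); apply: ball_triangle aa' _.
    apply: le_ball a'b; apply: ltW.
    by near: k; exact: near_infty_natSinv_lt (PosNum r20).
  have /rf/= fa' : ball (e a) r (e a').
    by apply: le_ball aa'; rewrite ler_pdivrMr// ler_peMr ?ler1n// ltW.
  have /rf/= fb := ab.
  rewrite (splitr eps) (le_trans (ler_distD (f a) _ _))// lerD// ?(ltW fb)//.
  by rewrite distrC ltW.
near=> k => a.
have [_ phi0 phi1 phib] := sphi k.
have -> : f a - \sum_(c <- s k) f c * phi k c a =
    \sum_(c <- s k) (f a - f c) * phi k c a.
  under [RHS]eq_bigr do rewrite mulrBl.
  by rewrite big_split/= sumrN -mulr_sumr phi1 mulr1.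
rewrite (le_trans (ler_norm_sum _ _ _))//.
rewrite -[leRHS]mulr1 -(phi1 a) mulr_sumr ler_sum// => c _.
rewrite normrM (ger0_norm (phi0 _ _)).
have [->|/phib ca] := eqVneq (phi k c a) 0; first by rewrite !mulr0.
rewrite ler_wpM2r//.
have /(_ a I c) : [set: T] `<=`
    [set a | forall b, ball (e a) k.+1%:R^-1 (e b) -> `|f a - f b| <= eps].
  by near: k.
by apply; exact: ball_sym.
Unshelve. all: by end_near. Qed.

(** A bound at all nodes passes to the interpolants, which are convex combinations of node values,
    and then to their limit. This gives density of the nodes in the form needed to replace suprema
    over [T] by countable ones. *)
Lemma interpolation_dense_seq (R : realType) (T : ptopologicalType)
    (s : nat -> seq T) (phi : nat -> T -> T -> R) :
  (forall k c a, 0 <= phi k c a) ->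
  (forall k a, \sum_(c <- s k) phi k c a = 1) ->
  (forall f : T -> R, continuous f -> forall eps : R, 0 < eps ->
      \forall k \near \oo, forall a,
        `|f a - \sum_(c <- s k) f c * phi k c a| <= eps) ->
  exists q : nat -> T, forall f : T -> R, continuous f ->
    forall M, (forall n, f (q n) <= M) -> forall a, f a <= M.
Proof.
move=> phi0 phi1 interp.
(* Enumerates the nodes of all the [s i]; the default [point] is harmless, since extra terms only
   strengthen the assumed bound. *)
exists (fun n => if (unpickle n : option (nat * nat)) is Some (i, j)
  then nth point (s i) j else point).
move=> f cf M fM a.
have fM' k c : c \in s k -> f c <= M.
  move=> cs; have := fM (pickle (k, index c (s k))).
  by rewrite pickleK nth_index.
apply/ler_addgt0Pr => eps eps0.
have [k _ /(_ _ (leqnn _) a) fk] := interp f cf eps eps0.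
have : \sum_(c <- s k) f c * phi k c a <= M.
  rewrite -[leRHS]mulr1 -(phi1 k a) mulr_sumr !big_seq ler_sum// => c cs.
  by rewrite ler_wpM2r//; exact: fM' cs.
move: fk; rewrite ler_norml => /andP[_]; rewrite lerBlDl => fk sM.
by rewrite (le_trans fk)// lerD2r.
Qed.

(** * Approximation uniformly over a family of measures *)

Lemma borel_measurable_open (T : ptopologicalType) (U : set T) :
  open U -> measurable (U : set (borel T)).
Proof. by move=> oU; apply: sub_sigma_algebra. Qed.

Lemma borel_continuous_measurable (R : realType) (T : ptopologicalType)
    (f : T -> R) :
  continuous f -> measurable_fun [set: borel T] (f : borel T -> R).
Proof.
move=> /continuousP cf; apply: (measurability _ (RGenOpens.measurableE R)).
move=> _ [_ [a [b ->] <-]]; rewrite setTI; apply: borel_measurable_open.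
exact/cf/interval_open.
Qed.

Section uniform_approximation.
Context (R : realType) (X A : ptopologicalType).
Variable M : set {measure set (borel X * borel A)%type -> \bar R}.

Definition uniformly_small (eps : R) (B : set (borel X)) :=
  measurable B /\ forall mu, M mu -> (mu (B `*` setT) <= eps%:E)%E.

Definition uniformly_vanishing := forall B : (set (borel X))^nat,
  (forall n, measurable (B n)) -> (forall x, \forall n \near \oo, ~ B n x) ->
  forall eps, 0 < eps -> exists n, uniformly_small eps (B n).

(** A Lusin property for the set function [nu], with closeness up to [eps] in place of equality, so
    that it passes easily to pointwise limits. *)
Definition quasicontinuous (f : borel X -> R) := forall eps, 0 < eps ->
  exists (h : borel X -> R) (B : set (borel X)), [/\ continuous h,
    exists K, forall x, `|h x| <= K, uniformly_small eps B &
    forall x, ~ B x -> `|f x - h x| <= eps].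

Lemma uniformly_small0 eps : 0 < eps -> uniformly_small eps set0.
Proof.
by move=> e0; split=> // mu _; rewrite set0X measure0 lee_fin ltW.
Qed.

Lemma uniformly_smallW e1 e2 B :
  e1 <= e2 -> uniformly_small e1 B -> uniformly_small e2 B.
Proof.
move=> e12 [mB sB]; split=> // mu /sB /le_trans; apply.
by rewrite lee_fin.
Qed.

Lemma uniformly_smallU e1 e2 B1 B2 : uniformly_small e1 B1 ->
  uniformly_small e2 B2 -> uniformly_small (e1 + e2) (B1 `|` B2).
Proof.
move=> [m1 s1] [m2 s2]; split=> [|mu Mmu]; first exact: measurableU.
have -> : (B1 `|` B2) `*` [set: borel A] = B1 `*` setT `|` B2 `*` setT.
  by apply/seteqP; split => -[y a]/=; rewrite /setX/=; tauto.
rewrite EFinD; apply: le_trans (leeD (s1 _ Mmu) (s2 _ Mmu)).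
by apply: measureU2; exact: measurableX.
Qed.

Lemma continuous_quasicontinuous (f : borel X -> R) :
  continuous f -> (exists K, forall x, `|f x| <= K) -> quasicontinuous f.
Proof.
move=> cf bf eps e0; exists f, set0; split=> //; first exact: uniformly_small0.
by move=> x _; rewrite subrr normr0 ltW.
Qed.

(** Applying [F] to approximations of [f] and [g] multiplies the errors by at most [K]. Sums,
    multiples and maxima are all instances. *)
Lemma quasicontinuous_lipschitz (F : R -> R -> R) (K : R) (f g : borel X -> R) :
  0 <= K -> (forall a b c d, `|F a b - F c d| <= K * (`|a - c| + `|b - d|)) ->
  quasicontinuous f -> quasicontinuous g ->
  quasicontinuous (fun x => F (f x) (g x)).
Proof.
move=> K0 FK qf qg eps e0.
(* The first bound keeps the union of the two exceptional sets [eps]-small, the second keeps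
   [K * (d + d)] below [eps]; the [+ 1] covers [K = 0]. *)
pose d := Num.min (eps / 2) (eps / (2 * (K + 1))).
have K1 : 0 < 2 * (K + 1) by lra.
have d0 : 0 < d by rewrite lt_min !divr_gt0.
have dK t : 0 < t -> K * (t / (2 * (K + 1)) + t / (2 * (K + 1))) <= t.
  move=> t0; have -> : K * (t / (2 * (K + 1)) + t / (2 * (K + 1))) = t * (K / (K + 1)).
    by field; rewrite gt_eqF//; lra.
  by rewrite ler_piMr ?(ltW t0)// ler_pdivrMr; lra.
have [h [B [ch [Kh hK] sB fh]]] := qf _ d0.
have [k [C [ck [Kk kK] sC gk]]] := qg _ d0.
exists (fun x => F (h x) (k x)), (B `|` C); split.
- move=> x; apply/cvgrPdist_le => /= t t0.
  have t1 : 0 < t / (2 * (K + 1)) by rewrite divr_gt0.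
  have /cvgrPdist_le/(_ _ t1) hx := ch x; have /cvgrPdist_le/(_ _ t1) kx := ck x.
  near=> y; apply: le_trans (FK _ _ _ _) (le_trans _ (dK _ t0)).
  by rewrite ler_wpM2l// lerD//; near: y.
- exists (`|F 0 0| + K * (Kh + Kk)) => x.
  rewrite -[F (h x) _](subrK (F 0 0)) addrC (le_trans (ler_normD _ _))// lerD2l.
  rewrite (le_trans (FK _ _ _ _))// ler_wpM2l// !subr0 lerD//.
- apply: (@uniformly_smallW (d + d)); last exact: uniformly_smallU.
  by rewrite [leRHS]splitr lerD// ge_min lexx.
- move=> x /not_orP[/fh fx /gk gx].
  apply: le_trans (FK _ _ _ _) (le_trans _ (dK _ e0)).
  rewrite ler_wpM2l// lerD//; [apply: le_trans fx _|apply: le_trans gx _];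
  by rewrite ge_min lexx orbT.
Unshelve. all: by end_near. Qed.

Lemma quasicontinuousD (f g : borel X -> R) : quasicontinuous f ->
  quasicontinuous g -> quasicontinuous (fun x => f x + g x).
Proof.
apply: (@quasicontinuous_lipschitz (fun a b => a + b) 1) => // a b c d.
by rewrite mul1r opprD addrACA ler_normD.
Qed.

Lemma quasicontinuousZ (k : R) (f : borel X -> R) : quasicontinuous f ->
  quasicontinuous (fun x => k * f x).
Proof.
move=> qf; apply: (@quasicontinuous_lipschitz (fun a _ => k * a) `|k| f f) => //.
by move=> a b c d; rewrite -mulrBr normrM ler_wpM2l// lerDl.
Qed.

Lemma quasicontinuous_max (f g : borel X -> R) : quasicontinuous f ->
  quasicontinuous g -> quasicontinuous (fun x => Num.max (f x) (g x)).
Proof.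
apply: (@quasicontinuous_lipschitz Num.max 1) => // a b c d; rewrite mul1r.
have := ler_norm (a - c); have := ler_norm (c - a); rewrite distrC.
have := ler_norm (b - d); have := ler_norm (d - b); rewrite (distrC d).
move: (`|a - c| : R) (`|b - d| : R) => u v ? ? ? ?.
rewrite ler_norml.
case: (ltP a b) => ?; case: (ltP c d) => ?; apply/andP; split; lra.
Qed.

Section vanishing.
Hypothesis vanish : uniformly_vanishing.

(** Each point lies in only finitely many of the sets where [f_ n] is more than [eps / 2] away from
    [f], so one of them is small, and that single [f_ n] suffices. *)
Lemma quasicontinuous_lim (f_ : nat -> borel X -> R) (f : borel X -> R) :
  (forall n, measurable_fun setT (f_ n)) -> measurable_fun setT f ->
  (forall n, quasicontinuous (f_ n)) -> (forall x, f_ ^~ x @ \oo --> f x) ->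
  quasicontinuous f.
Proof.
move=> mf_ mf qf_ f_f eps e0.
have e20 : 0 < eps / 2 by rewrite divr_gt0.
pose B n := [set x | eps / 2 < `|f x - f_ n x|].
have mB n : measurable (B n).
  rewrite -[B n]setTI; apply: measurable_fun_ltr => //.
  by apply: measurableT_comp => //; exact: measurable_funB.
have [|n sn] := vanish mB _ e20.
  move=> x; have /cvgrPdist_le/(_ _ e20) := f_f x; apply: filterS => n.
  by rewrite /B/=; rewrite leNgt => /negP.
have [h [C [ch bh sC fh]]] := qf_ n _ e20.
exists h, (B n `|` C); split=> //.
  by rewrite (splitr eps); exact: uniformly_smallU.
move=> x /not_orP[/negP + /fh fx]; rewrite -leNgt => fnx.
by rewrite (splitr eps) (le_trans (ler_distD (f_ n x) _ _))// lerD.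
Qed.

(** The measurable sets with quasicontinuous indicator form a sigma-algebra containing the open
    sets. Countable unions are limits of finite ones, whose indicators are maxima. *)
Lemma quasicontinuous_indic (P : pseudoMetricType R) (e : X -> P) (B : set (borel X)) :
  metric_embedding e -> measurable B -> quasicontinuous \1_B.
Proof.
move=> me mB.
suff : <<s @open X >> `<=` [set B | measurable (B : set (borel X)) /\
    quasicontinuous \1_B] by move=> /(_ _ mB)[].
apply: smallest_sub; last first.
  move=> U oU; have mU := borel_measurable_open oU; split=> //.
  have [f [cf f01 fU]] := open_indic_continuous_limit me oU.
  apply: (@quasicontinuous_lim f).
  - by move=> n; exact: borel_continuous_measurable.
  - by [].
  - move=> n; apply: continuous_quasicontinuous; first exact: cf.
    by exists 1 => x; have /andP[? ?] := f01 n x; rewrite ger0_norm.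
  - move=> x; apply: cvg_near_cst; exact: fU.
have q0 : quasicontinuous \1_set0.
  rewrite indic0; apply: continuous_quasicontinuous; first by move=> x; exact: cvg_cst.
  by exists 0 => x; rewrite normr0.
have q1 : quasicontinuous (cst 1).
  apply: continuous_quasicontinuous; first by move=> x; exact: cvg_cst.
  by exists 1 => x; rewrite normr1.
split=> [|C [mC qC]|C_ C_P].
- by split=> //.
- rewrite setTD; split; first exact: measurableC.
  have -> : \1_(~` C) = (fun x => 1 + -1 * \1_C x) :> (borel X -> R).
    by apply/funext => x; rewrite mulN1r !indicE in_setC; case: (_ \in _); rewrite /= ?subrr ?subr0.
  by apply: quasicontinuousD => //; exact: quasicontinuousZ.
- have mC n : measurable (C_ n : set (borel X)) by have [] := C_P n.
  have mCk : measurable (\bigcup_k C_ k : set (borel X)) by exact: bigcupT_measurable.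
  split=> //.
  apply: (@quasicontinuous_lim (fun n => \1_(\big[setU/set0]_(i < n) C_ i))).
  - by move=> n; apply: measurable_indic; exact: bigsetU_measurable.
  - exact: measurable_indic.
  - elim=> [|n IH]; first by rewrite big_ord0.
    rewrite big_ord_recr/=.
    have -> : \1_(\big[setU/set0]_(i < n) C_ i `|` C_ n) =
        (fun x => Num.max (\1_(\big[setU/set0]_(i < n) C_ i) x) (\1_(C_ n) x))
        :> (borel X -> R).
      apply/funext => x; rewrite !indicE in_setU.
      case: (x \in \big[_/_]_(_ < _) _); case: (x \in _) => /=;
        by rewrite /Num.max ?ltxx ?ltr01// ltNge ler01.
    by apply: quasicontinuous_max => //; have [] := C_P n.
  - move=> x; apply: cvg_near_cst.
    have [[k _ kx]|nx] := pselect ((\bigcup_k C_ k) x).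
      exists k.+1 => // n /= kn; rewrite !indicE !mem_set//; first by exists k.
      by rewrite -bigcup_mkord; exists k.
    apply: nearW => n; rewrite !indicE !memNset//.
    by rewrite -bigcup_mkord => -[k _ kx]; apply: nx; exists k.
Qed.

Import HBSimple.

Lemma quasicontinuous_measurable (P : pseudoMetricType R) (e : X -> P)
    (f : borel X -> R) :
  metric_embedding e -> measurable_fun setT f -> quasicontinuous f.
Proof.
move=> me mf.
have mEf : measurable_fun setT (EFin \o f) by exact/measurable_EFinP.
have [g gf] := approximation_sfun measurableT mEf.
apply: (@quasicontinuous_lim (fun n => g n : borel X -> R)) => //.
- move=> n; have -> : (g n : borel X -> R) = (fun x =>
    \sum_(y <- finmap.enum_fset (fset_set (range (g n)))) y * \1_(g n @^-1` [set y]) x).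
    by apply/funext => x; rewrite {1}fimfunE fsbig_finite.
  elim: (finmap.enum_fset _) => [|y s IH].
    under eq_fun do rewrite big_nil.
    apply: continuous_quasicontinuous; first by move=> x; exact: cvg_cst.
    by exists 0 => x; rewrite normr0.
  under eq_fun do rewrite big_cons.
  apply: quasicontinuousD => //; apply: quasicontinuousZ.
  exact: (quasicontinuous_indic me).
- by move=> x; have /fine_cvgP[] := gf x I.
Qed.

(** Finitely many functions share one exceptional set: the tolerance is halved at each entry of [s]
    and the exceptional sets are united. *)
Lemma quasicontinuous_seq (P : pseudoMetricType R) (e : X -> P) (I : eqType)
    (s : seq I) (f : I -> borel X -> R) (K eps : R) :
  metric_embedding e -> 0 <= K -> (forall i, measurable_fun setT (f i)) ->
  (forall i x, `|f i x| <= K) -> 0 < eps ->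
  exists (h : I -> borel X -> R) (B : set (borel X)),
    [/\ forall i, continuous (h i), forall i x, `|h i x| <= K,
      uniformly_small eps B & forall i, i \in s -> forall x, ~ B x ->
        `|f i x - h i x| <= eps].
Proof.
move=> me K0 mf fK; elim: s eps => [|c s IH] eps e0.
  exists (fun _ => cst 0), set0; split=> //; last exact: uniformly_small0.
    by move=> i x; exact: cvg_cst.
  by move=> i x; rewrite normr0.
have e20 : 0 < eps / 2 by rewrite divr_gt0.
have e2 : eps / 2 <= eps by rewrite ler_pdivrMr// ler_peMr// ?ler1n// ltW.
have [h [B [ch hK sB fh]]] := IH _ e20.
have [k [C [ck _ sC fk]]] := quasicontinuous_measurable me (mf c) e20.
(* Truncation to [[-K, K]] keeps continuity and does not increase the distance to [f c], whose
   values lie in that interval. *)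
pose k' := fun x => Num.max (- K) (Num.min K (k x)).
exists (fun i => if i == c then k' else h i), (B `|` C); split.
- move=> i; case: eqP => // _ x.
  have cK (r : R) : {for x, continuous (cst r : borel X -> R)} by exact: cvg_cst.
  exact: (continuous_max (cK (- K)) (continuous_min (cK K) (ck x))).
- move=> i x; case: eqP => // _.
  rewrite /k' ler_norml; case: (ltP K (k x)) => ?;
    [case: (ltP (- K) K) => ?|case: (ltP (- K) (k x)) => ?]; apply/andP; split; lra.
- by rewrite (splitr eps); exact: uniformly_smallU.
- move=> i + x /not_orP[nB nC]; rewrite in_cons; case: eqP => /= [-> _|_ is_].
    apply: le_trans e2; apply: le_trans (fk x nC).
    have := fK c x; rewrite ler_norml => /andP[? ?].
    have := ler_norm (f c x - k x); have := ler_norm (k x - f c x); rewrite (distrC (k x)).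
    move: (`|f c x - k x| : R) => u ? ?.
    rewrite /k' ler_norml; case: (ltP K (k x)) => ?;
    [case: (ltP (- K) K) => ?|case: (ltP (- K) (k x)) => ?]; apply/andP; split; lra.
  by apply: le_trans e2; exact: fh.
Qed.

(** Off a small set of states, [g] is within [d] of its interpolant, and the interpolant within [d]
    of [G]; on that set [|g - G|] is at most [2 * K]. *)
Lemma caratheodory_uniform_approximation (P : pseudoMetricType R) (e : X -> P)
    (Q : pseudoMetricType R) (e' : A -> Q) (C K eps : R)
    (g : (borel X * borel A)%type -> R) :
  metric_embedding e -> metric_embedding e' -> compact [set: A] ->
  0 <= C -> (forall mu, M mu -> (mu setT <= C%:E)%E) ->
  measurable_fun setT g -> (forall z, `|g z| <= K) ->
  (forall y, continuous (fun a : borel A => g (y, a))) -> 0 < eps ->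
  exists G : (borel X * borel A)%type -> R, [/\ continuous G,
    measurable_fun setT G, forall z, `|G z| <= K &
    forall mu, M mu -> (\int[mu]_z (`|g z - G z|)%:E <= eps%:E)%E].
Proof.
move=> me me' cA C0 MC mg gK cg e0.
have K0 : 0 <= K by apply: le_trans (gK point).
have [s [phi [cphi phi0 phi1 interp]]] := compact_interpolation me' cA.
have [q qP] := interpolation_dense_seq phi0 phi1 interp.
(* Chosen so that the final bound [2 * d * C + 2 * K * (d + d)] is at most [eps]; the [+ 1] keeps
   the denominator positive. *)
pose d := eps / (2 * (C + 2 * K + 1)).
have CK0 : 0 < 2 * (C + 2 * K + 1) by lra.
have d0 : 0 < d by rewrite divr_gt0.
have mgc c : measurable_fun setT (fun y : borel X => g (y, c)).
  by apply: measurableT_comp => //; exact: measurable_pair2.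
have mphi k c : measurable_fun setT (phi k c : borel A -> R).
  by apply: borel_continuous_measurable; exact: cphi.
pose osc k a y := `|g (y, a) - \sum_(c <- s k) g (y, c) * phi k c a|.
(* The states at which the interpolation error exceeds [d] for some action; testing only the actions
   [q n] makes this set measurable. *)
pose B k := \bigcup_n [set y : borel X | d < osc k (q n) y].
have mB k : measurable (B k).
  apply: bigcupT_measurable => n; rewrite -[X in measurable X]setTI.
  apply: measurable_fun_ltr => //; apply: measurableT_comp => //.
  apply: measurable_funB => //; apply: measurable_sum => c.
  exact: measurable_funM.
have csum k (f : A -> R) : continuous (fun a : A => \sum_(c <- s k) f c * phi k c a).
  by apply: continuous_sum => c a; apply: cvgM; [exact: cvg_cst|exact: cphi].
(* For fixed [y] the interpolants of [g (y, .)] converge uniformly, so [y] lies in finitely many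
   [B k]. *)
have [y|k sk] := vanish mB _ d0.
  have := interp _ (cg y) _ d0; apply: filterS => k kd [n _ /=].
  by rewrite /osc ltNge kd.
have oscd y : ~ B k y -> forall a, osc k a y <= d.
  move=> nBy; apply: (qP (fun a => osc k a y)).
    move=> a; apply: cvg_norm; apply: cvgB; first exact: cg.
    exact: csum.
  by move=> n; rewrite leNgt; apply/negP => kn; apply: nBy; exists n.
have [h [D [ch hK sD gh]]] := quasicontinuous_seq (s k) me K0 mgc
  (fun c y => gK (y, c)) d0.
pose G (z : borel X * borel A) := \sum_(c <- s k) h c z.1 * phi k c z.2.
have cG : continuous G.
  apply: continuous_sum => c z; apply: cvgM; apply: continuous_comp.
  - exact: cvg_fst.
  - exact: ch.
  - exact: cvg_snd.
  - exact: cphi.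
have mG : measurable_fun setT G.
  apply: measurable_sum => c; apply: measurable_funM.
    apply: measurableT_comp => //; apply: borel_continuous_measurable; exact: ch.
  exact: measurableT_comp.
have GK z : `|G z| <= K.
  rewrite (le_trans (ler_norm_sum _ _ _))// -[leRHS]mulr1 -(phi1 k z.2) mulr_sumr.
  by apply: ler_sum => c _; rewrite normrM (ger0_norm (phi0 _ _ _)) ler_wpM2r.
exists G; split=> // mu Mmu.
have mBD : measurable ((B k `|` D) `*` [set: borel A]).
  by apply: measurableX => //; apply: measurableU => //; case: sD.
have bnd z : `|g z - G z| <= 2 * d + 2 * K * \1_((B k `|` D) `*` setT) z.
  rewrite indicE; have [|nz] := boolP (z \in _).
    move=> _; rewrite mulr1 (le_trans (ler_normB _ _))// (le_trans (lerD (gK z) (GK z)))//.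
    by lra.
  rewrite mulr0 addr0; move: nz; rewrite notin_setE.
  case: z => y a /= /not_andP[/not_orP[nB nD]|//].
  have := oscd _ nB a; rewrite /osc => gS.
  rewrite (le_trans (ler_distD (\sum_(c <- s k) g (y, c) * phi k c a) _ _))//.
  rewrite (_ : 2 * d = d + d) ?lerD//; last lra.
  rewrite /G -sumrB (le_trans (ler_norm_sum _ _ _))// -[leRHS]mulr1 -(phi1 k a).
  rewrite mulr_sumr !big_seq; apply: ler_sum => c cs /=.
  by rewrite -mulrBl normrM (ger0_norm (phi0 _ _ _)) ler_wpM2r// gh.
have dK2 : 0 <= 2 * K by lra.
apply: (@le_trans _ _ (\int[mu]_z ((2 * d)%:E + (2 * K)%:E * (\1_((B k `|` D) `*` setT) z)%:E))%E).
  apply: ge0_le_integral => //.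
  - by apply/measurable_EFinP; apply: measurableT_comp => //; exact: measurable_funB.
  - apply: emeasurable_funD => //; apply: measurable_funeM.
    by apply/measurable_EFinP; exact: measurable_indic.
  - by move=> z _; rewrite -EFinM -EFinD lee_fin.
rewrite ge0_integralD//; last 3 first.
- by move=> z _; rewrite lee_fin; lra.
- by move=> z _; rewrite -EFinM lee_fin mulr_ge0.
- by apply: measurable_funeM; apply/measurable_EFinP; exact: measurable_indic.
rewrite integral_cst// ge0_integralZl//; last first.
  by apply/measurable_EFinP; exact: measurable_indic.
rewrite integral_indic// setIT.
have [_ /(_ _ Mmu) small] := uniformly_smallU sk sD.
apply: (@le_trans _ _ ((2 * d)%:E * C%:E + (2 * K)%:E * (d + d)%:E)%E).
  apply: leeD; apply: lee_wpmul2l; rewrite ?lee_fin//; [lra|exact: MC].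
rewrite -!EFinM -EFinD lee_fin.
have -> : 2 * d * C + 2 * K * (d + d) = eps * ((C + 2 * K) / (C + 2 * K + 1)).
  by rewrite /d; field; rewrite gt_eqF//; lra.
by rewrite ler_piMr ?(ltW e0)// ler_pdivrMr; lra.
Qed.

End vanishing.
End uniform_approximation.

(** * The maximal transition operator *)

Section disintegration.
Context (R : realType) (d1 d2 : measure_display) (S : measurableType d1)
  (T : measurableType d2) (P : probability S R) (k : S -> probability T R).
Hypothesis mk : forall C, measurable C -> measurable_fun setT (fun s => k s C).

(** [P] as a kernel with one-point source, so that integration against a composition of kernels
    applies. *)
Definition constant_kernel (_ : unit) : {measure set S -> \bar R} := P.

Let constant_kernel_measurable U : measurable U ->
  measurable_fun setT (constant_kernel ^~ U).
Proof. by move=> _; exact: measurable_cst. Qed.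

HB.instance Definition _ := isKernel.Build _ _ _ _ R constant_kernel
  constant_kernel_measurable.

Let constant_kernel_setT x : constant_kernel x setT = 1%E.
Proof. exact: probability_setT. Qed.

HB.instance Definition _ := Kernel_isProbability.Build _ _ _ _ R constant_kernel
  constant_kernel_setT.

(** The source [unit * S] is the one required by kernel composition. The measurability proof is an
    argument so that the kernel structure can be attached to the term. *)
Definition snd_kernel (_ : forall C, measurable C -> measurable_fun setT (fun s => k s C))
  (z : unit * S) : {measure set T -> \bar R} := k z.2.

Let snd_kernel_measurable U : measurable U -> measurable_fun setT (snd_kernel mk ^~ U).
Proof. by move=> mU; apply: (measurableT_comp (mk mU)); exact: measurable_snd. Qed.

HB.instance Definition _ := isKernel.Build _ _ _ _ R (snd_kernel mk)
  snd_kernel_measurable.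

Let snd_kernel_setT x : snd_kernel mk x setT = 1%E.
Proof. exact: probability_setT. Qed.

HB.instance Definition _ := Kernel_isProbability.Build _ _ _ _ R (snd_kernel mk)
  snd_kernel_setT.

(** The law of [X] under [P] is the composition of [P] with [k], against which integrals are
    iterated integrals. *)
Lemma ge0_integral_disintegration (X : S -> T) (f : T -> \bar R) :
  measurable_fun setT X ->
  (forall C, measurable C -> P (X @^-1` C) = (\int[P]_s k s C)%E) ->
  (forall t, (0 <= f t)%E) -> measurable_fun setT f ->
  (\int[P]_s f (X s) = \int[P]_s \int[k s]_t f t)%E.
Proof.
move=> mX PX f0 mf.
have <- := integral_kcomp constant_kernel (snd_kernel mk) tt f0 mf.
transitivity (\int[pushforward P X]_t f t)%E.
  by rewrite ge0_integral_pushforward.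
by apply: eq_measure_integral => C mC _; exact: PX.
Qed.

End disintegration.

Section transition.
Context (R : realType) (X A : ptopologicalType).
Variable p : (borel X * borel A)%type -> probability (borel X) R.
Hypothesis kp : is_kernel p.
Hypothesis condS : condition_S p.
Variable q : nat -> A.
Hypothesis qdense : forall f : A -> R, continuous f ->
  forall M, (forall n, f (q n) <= M) -> forall a, f a <= M.

Definition unit_fun (f : borel X -> R) :=
  measurable_fun setT f /\ forall x, 0 <= f x <= 1.

Lemma unit_fun_indic (B : set (borel X)) : measurable B -> unit_fun \1_B.
Proof.
move=> mB; split; first exact: measurable_indic.
by move=> y; rewrite indicE; case: (_ \in _); rewrite /= ?lexx ?ler01.
Qed.

Definition transition (f : borel X -> R) (x : borel X) (a : borel A) : R :=
  fine (\int[p (x, a)]_y (f y)%:E).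

(** The operator [T] of the introduction. The supremum runs over the sequence [q] only, which gives
    measurability; density of [q] makes it a supremum over all actions. *)
Definition max_transition (f : borel X -> R) (x : borel X) : R :=
  sups (fun n => transition f x (q n)) 0%N.

Lemma transition_bounds f x a : unit_fun f ->
  (0 <= \int[p (x, a)]_y (f y)%:E <= 1)%E.
Proof.
move=> [mf f01]; apply/andP; split.
  by apply: integral_ge0 => y _; rewrite lee_fin; case/andP: (f01 y).
apply: (@le_trans _ _ (\int[p (x, a)]_y (cst 1 y))%E).
  apply: ge0_le_integral => //.
  - by move=> y _; rewrite lee_fin; case/andP: (f01 y).
  - exact/measurable_EFinP.
  - by move=> y _; rewrite lee_fin; case/andP: (f01 y).
by rewrite integral_cst// mul1e; exact: probability_le1.
Qed.

Lemma transitionE f x a : unit_fun f ->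
  (\int[p (x, a)]_y (f y)%:E)%E = (transition f x a)%:E.
Proof.
move=> uf; rewrite fineK//; have /andP[l u] := transition_bounds x a uf.
by rewrite ge0_fin_numE// (le_lt_trans u)// ltry.
Qed.

Lemma transition01 f x a : unit_fun f -> 0 <= transition f x a <= 1.
Proof.
by move=> uf; have := transition_bounds x a uf; rewrite transitionE// !lee_fin.
Qed.

Lemma transition_continuous f x : unit_fun f -> continuous (transition f x).
Proof.
move=> [mf f01]; apply: condS.2 => //; exists 1 => y.
by have /andP[? ?] := f01 y; rewrite ger0_norm.
Qed.

Lemma transition_has_ubound f x : unit_fun f ->
  has_ubound (range (fun n => transition f x (q n))).
Proof.
by move=> uf; exists 1 => _ [n _ <-]; case/andP: (transition01 x (q n) uf).
Qed.

Lemma max_transition_ge f x a : unit_fun f -> transition f x a <= max_transition f x.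
Proof.
move=> uf.
suff H n : transition f x (q n) <= max_transition f x.
  exact: (@qdense _ (@transition_continuous f x uf) _ H a).
rewrite /max_transition /sups/=; apply: ub_le_sup.
  by exists 1 => _ [m _ <-]; case/andP: (transition01 x (q m) uf).
by exists n.
Qed.

Lemma max_transition_le f x M : (forall a, transition f x a <= M) ->
  max_transition f x <= M.
Proof.
move=> fM; apply: ge_sup; first by exists (transition f x (q 0)), 0%N.
by move=> _ [n _ <-].
Qed.

Lemma max_transition_unit_fun f : unit_fun f -> unit_fun (max_transition f).
Proof.
move=> uf; split.
  apply: measurable_fun_sups => [x _|n]; first exact: transition_has_ubound.
  apply: measurableT_comp => //.
  apply: (@measurable_fun_integral_kernel _ _ _ _ _ (fun x => p (x, q n))).
  - by move=> U mU; apply: (measurableT_comp (kp mU)); exact: measurable_pair2.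
  - by move=> y; rewrite lee_fin; case/andP: (uf.2 y).
  - by apply/measurable_EFinP; case: uf.
move=> x; apply/andP; split.
  by apply: le_trans (max_transition_ge x (q 0) uf); case/andP: (transition01 x (q 0) uf).
by apply: max_transition_le => a; case/andP: (transition01 x a uf).
Qed.

Definition vanishing_seq (f : nat -> borel X -> R) :=
  [/\ forall k, unit_fun (f k), forall x, nonincreasing_seq (f ^~ x) &
      forall x, f ^~ x @ \oo --> 0].

Lemma transition_le f g x a : unit_fun f -> unit_fun g ->
  (forall y, f y <= g y) -> transition f x a <= transition g x a.
Proof.
move=> uf ug fg; rewrite -lee_fin -!transitionE//.
apply: ge0_le_integral => //.
- by move=> y _; rewrite lee_fin; case/andP: (uf.2 y).
- by apply/measurable_EFinP; case: uf.
- by apply/measurable_EFinP; case: ug.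
- by move=> y _; rewrite lee_fin.
Qed.

(* Dini's theorem on the compact set of actions. *)
Lemma vanishing_max_transition f :
  vanishing_seq f -> vanishing_seq (fun k => max_transition (f k)).
Proof.
move=> [uf nif f0]; split=> [k|x|x].
- exact: max_transition_unit_fun.
- move=> m n mn; apply: max_transition_le => a.
  apply: le_trans (max_transition_ge x a (uf m)).
  by apply: transition_le => // y; exact: nif.
(* Dominated convergence handles each action separately; compactness then makes it uniform. *)
have If0 a : (fun k => transition (f k) x a) @ \oo --> 0.
  have mf k : measurable_fun setT (fun y => (f k y)%:E).
    by apply/measurable_EFinP; case: (uf k).
  have ff0 : {ae p (x, a), forall y, setT y -> (fun k => (f k y)%:E) @ \oo --> cst 0%E y}.
    by apply: aeW => y _; apply: cvg_EFin; [exact: nearW|exact: f0].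
  have f1 : {ae p (x, a), forall y k, setT y -> (`|(f k y)%:E| <= cst 1%E y)%E}.
    apply: aeW => y k _; rewrite lee_fin; have /andP[? ?] := (uf k).2 y.
    by rewrite ger0_norm.
  have i1 : (p (x, a)).-integrable setT (cst 1%E).
    exact: finite_measure_integrable_cst.
  have [_ _] := dominated_convergence measurableT mf (@measurable_cst _ _ _ _ _ _)
    ff0 i1 f1.
  by rewrite integral0 => /fine_cvgP[].
apply/cvgrPdist_le => /= eps e0.
have /compact_near_coveringP ncA := condS.1.
have : \forall k \near \oo, [set: A] `<=` [set a | transition (f k) x a <= eps].
  apply: ncA => a _.
  have e20 : 0 < eps / 2 by rewrite divr_gt0.
  have /cvgrPdist_le/(_ _ e20)[N _ /(_ _ (leqnn N)) Na] := If0 a.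
  have /cvgrPdist_le/(_ _ e20) ca := @transition_continuous _ x (uf N) a.
  (* Monotonicity in [k] reduces every [k >= N] to [f N], and continuity at [a] costs at most
     another [eps / 2]. *)
  exists ([set b | `|transition (f N) x a - transition (f N) x b| <= eps / 2],
          [set k | (N <= k)%N]); first by split => //; exists N.
  move=> [b k] /= [ab Nk].
  apply: (@le_trans _ _ (transition (f N) x b)).
    by apply: transition_le => // y; exact: nif.
  move: ab Na; rewrite sub0r normrN !ler_norml => /andP[? ?] /andP[? ?]; lra.
apply: filterS => k kA; rewrite sub0r normrN ger0_norm; last first.
  by case/andP: ((max_transition_unit_fun (uf k)).2 x).
by apply: max_transition_le => a; exact: kA.
Qed.

End transition.

(** * Strategic measures and occupation measures *)

Lemma Borel_space_closed_set1 (R : realType) (T : topologicalType) (x : T) :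
  is_Borel_space R (setT : set T) -> closed [set x].
Proof.
move=> [P [B [e [hP [_ [_ [einj [_ [ce _]]]]]]]]].
have -> : [set x] = e @^-1` [set e x].
  apply/seteqP; split => [y ->//|y /= exy].
  by apply: einj; rewrite ?in_setT.
have ce' : continuous e by exact/continuous_subspace_setT.
apply: closed_comp; first by move=> y _; exact: ce'.
exact/accessible_closed_set1/hausdorff_accessible.
Qed.

Section coordinates.
Context (X A : ptopologicalType).

Lemma measurable_coordinate n :
  measurable_fun setT (fun h : hist X A => h n).
Proof.
by move=> _ B mB; rewrite setTI; apply: sub_sigma_algebra; exists n, B.
Qed.

Lemma measurable_state n :
  measurable_fun setT (fun h : hist X A => (h n).1).
Proof. exact: (measurableT_comp measurable_fst (measurable_coordinate n)). Qed.

End coordinates.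

Section occupation_measure.
Context (R : realType) (X A : ptopologicalType) (Delta : X).
Hypothesis oDelta : open [set Delta].

Lemma measurable_Delta : measurable ([set Delta] : set (borel X)).
Proof. exact: borel_measurable_open. Qed.

Lemma measurable_YA : measurable (YA Delta : set (borel X * borel A)%type).
Proof.
have -> : (YA Delta : set (borel X * borel A)%type) = ~` [set Delta] `*` setT.
  by apply/seteqP; split => -[y a]//= -[].
by apply: measurableX => //; apply: measurableC; exact: measurable_Delta.
Qed.

Variable P : probability (hist X A) R.

Lemma occupationE (D : set (borel X * borel A)%type) : measurable D ->
  occupation Delta P D =
  (\sum_(0 <= n <oo) P [set h : hist X A | (D `&` YA Delta) (h n)])%E.
Proof.
move=> mD; have mDY := measurableI _ _ mD measurable_YA.
have mcD n : measurable [set h : hist X A | (D `&` YA Delta) (h n)].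
  by rewrite -[X in measurable X]setTI; exact: measurable_coordinate.
rewrite /occupation integral_nneseries//.
- apply: eq_eseriesr => n _.
  rewrite -[in RHS](setIT [set h | _]) -integral_indic//.
- move=> n; apply/measurable_EFinP.
  exact: (measurableT_comp (measurable_indic mDY) (@measurable_coordinate X A n)).
Qed.

(** Openness of [Delta] is an argument because sigma-additivity relies on the measurability of
    [YA Delta]. *)
Definition occupation_measure (_ : open [set Delta]) := occupation Delta P.

Let occupation_measure0 : occupation_measure oDelta set0 = 0%E.
Proof.
rewrite /occupation_measure occupationE// eseries0// => n _ _.
by under eq_set do rewrite set0I; rewrite measure0.
Qed.

Let occupation_measure_ge0 D : (0 <= occupation_measure oDelta D)%E.
Proof. by apply: integral_ge0 => h _; apply: nneseries_ge0 => n _ _; rewrite lee_fin. Qed.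

Let occupation_measure_sigma_additive :
  semi_sigma_additive (occupation_measure oDelta).
Proof.
move=> F mF tF mUF.
pose S n i := [set h : hist X A | (F i `&` YA Delta) (h n)].
have mS n i : measurable (S n i).
  rewrite -[X in measurable X]setTI; apply: measurable_coordinate => //.
  by apply: measurableI => //; exact: measurable_YA.
have -> : occupation_measure oDelta (\bigcup_i F i) =
    limn (fun n => \sum_(0 <= i < n) occupation_measure oDelta (F i))%E.
  rewrite /occupation_measure occupationE//.
  transitivity (\sum_(0 <= n <oo) \sum_(0 <= i <oo) P (S n i))%E.
    apply: eq_eseriesr => n _; rewrite -measure_semi_bigcup//.
    + by congr (P _); apply/seteqP; split=> [h [[i _ Fi] Yh]|h [i _ [Fi Yh]]];
        [exists i|split=> //; exists i].
    + apply/trivIsetP => i j _ _ ij.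
      move/trivIsetP : tF => /(_ i j I I ij) FF.
      apply/seteqP; split=> // h [[Fi _] [Fj _]] /=.
      by have : (F i `&` F j) (h n) by []; rewrite FF.
    + exact: bigcupT_measurable.
  (* Sigma-additivity amounts to exchanging the sum over time with the sum over the pieces [F i]. *)
  rewrite nneseries_interchange//.
  by apply: eq_eseriesr => i _; rewrite occupationE.
exact: is_cvg_ereal_nneg_natsum.
Qed.

HB.instance Definition _ := isMeasure.Build _ _ _ (occupation_measure oDelta)
  occupation_measure0 occupation_measure_ge0 occupation_measure_sigma_additive.

End occupation_measure.

Lemma lt_tauP (R : realType) (X A : ptopologicalType) (Delta : X) t (h : hist X A) :
  ((t%:R)%:E < tau R Delta h)%E <-> forall s, (s <= t)%N -> (h s).1 <> Delta.
Proof.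
split=> [tt s st hs|ht].
  move: tt; rewrite ltNge => /negP; apply.
  apply: (@le_trans _ _ (s%:R)%:E); last by rewrite lee_fin ler_nat.
  by apply: ereal_inf_lbound; exists s.
(* Hitting times are integers, so avoiding [Delta] up to [t] gives [tau >= t + 1], also when [Delta]
   is never hit. *)
apply: (@lt_le_trans _ _ (t.+1%:R)%:E); first by rewrite lte_fin ltr_nat.
apply: le_ereal_inf_tmp => _ [s /= hs <-]; rewrite lee_fin ler_nat ltnNge.
by apply/negP => /ht; apply.
Qed.

Lemma ge0_emeasurable_tail (R : realType) (d : measure_display)
    (T : measurableType d) (u : nat -> T -> \bar R) n :
  (forall k x, 0 <= u k x)%E -> (forall k, measurable_fun setT (u k)) ->
  measurable_fun setT (fun x => \sum_(n <= t <oo) u t x)%E.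
Proof.
move=> u0 mu; under eq_fun do rewrite ereal_series.
by apply: (ge0_emeasurable_sum (P := fun t => (n <= t)%N)).
Qed.

Section strategic_measure.
Context (R : realType) (X A : ptopologicalType) (Delta : X).
Variable p : (borel X * borel A)%type -> probability (borel X) R.
Hypothesis kp : is_kernel p.
Variables (x : X) (pi : strategy R X A) (P : probability (hist X A) R).
Hypothesis smP : is_strategic_measure p x pi P.

Section state_law.
Hypothesis condS : condition_S p.
Hypothesis cx : closed [set x].
Variable q : nat -> A.
Hypothesis qdense : forall f : A -> R, continuous f ->
  forall M, (forall n, f (q n) <= M) -> forall a, f a <= M.

(** Given the history up to the action, the next state has law [p (h n)], and the resulting integral
    of [f] is at most its supremum over actions. *)
Lemma integral_state_step n (f : borel X -> R) : unit_fun f ->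
  (\int[P]_h (f (h n.+1).1)%:E <= \int[P]_h (max_transition p q f (h n).1)%:E)%E.
Proof.
move=> uf; have [_ _ Ptrans] := smP.
have mk C : measurable C -> measurable_fun setT (fun h : hist X A => p (h n) C).
  by move=> mC; exact: (measurableT_comp (kp mC) (@measurable_coordinate X A n)).
have mf : measurable_fun setT (EFin \o f) by apply/measurable_EFinP; case: uf.
have f0 y : (0 <= (EFin \o f) y)%E by rewrite lee_fin; case/andP: (uf.2 y).
have PX C : measurable C ->
    P ((fun h : hist X A => (h n.+1).1) @^-1` C) = (\int[P]_h p (h n) C)%E.
  move=> mC; rewrite -Ptrans ?setTI//.
  apply: sub_sigma_algebra; exists n, setT; split => //; split => //.
have -> := ge0_integral_disintegration mk (@measurable_state X A n.+1) PX f0 mf.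
apply: ge0_le_integral => //.
- by move=> h _; apply: integral_ge0.
- apply: (@measurable_fun_integral_kernel _ _ _ _ _ (fun h : hist X A => p (h n))) => //.
- apply/measurable_EFinP.
  apply: (measurableT_comp _ (@measurable_state X A n)).
  by case: (max_transition_unit_fun kp condS qdense uf).
- move=> h _; rewrite [h n]surjective_pairing/= transitionE// lee_fin.
  exact: max_transition_ge.
Qed.

(** Iterating the one-step bound back to [X_0 = x] gives a bound that does not depend on the
    strategy. *)
Lemma integral_state_le n (f : borel X -> R) : unit_fun f ->
  (\int[P]_h (f (h n).1)%:E <= (iter n (max_transition p q) f x)%:E)%E.
Proof.
elim: n f => [|n IH] f uf; last first.
  rewrite iterSr; apply: le_trans (integral_state_step n uf) (IH _ _).
  exact: max_transition_unit_fun.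
have [P0 _ _] := smP.
have mx : measurable [set h : hist X A | (h 0%N).1 = x].
  have mx : measurable ([set x] : set (borel X)).
    rewrite -[X in measurable X]setCK; apply: measurableC.
    by apply: borel_measurable_open; exact: closed_openC.
  by rewrite -[X in measurable X]setTI; exact: (measurable_state 0%N measurableT mx).
rewrite (@ae_eq_integral _ _ _ P setT (cst (f x)%:E))//.
- rewrite integral_cst//= -[leRHS]mule1 lee_wpmul2l//; last exact: probability_le1.
  by rewrite lee_fin; case/andP: (uf.2 x).
- apply/measurable_EFinP; apply: (measurableT_comp _ (measurable_state 0%N)).
  by case: uf.
- exists (~` [set h : hist X A | (h 0%N).1 = x]); split.
  + exact: measurableC.
  + by apply: etrans (probability_setC P mx) _; rewrite P0 subee.
  + by apply: subsetC => h /= <-.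
Qed.

Lemma prob_state_le n (B : set (borel X)) : measurable B ->
  (P [set h : hist X A | B (h n).1] <= (iter n (max_transition p q) \1_B x)%:E)%E.
Proof.
move=> mB; have uB := unit_fun_indic R mB.
apply: le_trans (integral_state_le n uB).
have mBn : measurable [set h : hist X A | B (h n).1].
  by rewrite -[X in measurable X]setTI; exact: measurable_state.
by rewrite -[in leLHS](setIT [set h | _]) -integral_indic.
Qed.

End state_law.

Hypothesis oDelta : open [set Delta].
Hypothesis absorbing : forall a : A, p (Delta, a) [set Delta] = 1%E.

(** Leaving [Delta] at some time [n] is a null event because [p (Delta, a)] is concentrated on
    [Delta]; there are countably many such events. *)
Lemma state_absorbed : {ae P, forall h : hist X A, forall t, (h t).1 <> Delta ->
  forall s, (s <= t)%N -> (h s).1 <> Delta}.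
Proof.
have [_ _ Ptrans] := smP.
have mD := measurable_Delta oDelta.
pose S n := [set h : hist X A | (h n).1 = Delta].
have sS n : <<s G_hista n >> (S n).
  apply: sub_sigma_algebra; exists n, ([set Delta] `*` setT); split=> //; split.
    exact: measurableX.
  by apply/seteqP; split => h /=; [|case].
have N0 n : P (S n `&` [set h : hist X A | (~` [set Delta]) (h n.+1).1]) = 0%E.
  rewrite Ptrans//; last exact: measurableC.
  apply: integral0_eq => h /= hn; rewrite [h n]surjective_pairing hn.
  by apply: etrans (probability_setC _ mD) _; rewrite [X in (1 - X)%E]absorbing subee.
have mN n : measurable (S n `&` [set h : hist X A | (~` [set Delta]) (h n.+1).1]).
  apply: measurableI; rewrite -[X in measurable X]setTI.
    exact: (measurable_state n measurableT mD).
  exact: (measurable_state n.+1 measurableT (measurableC mD)).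
have : P.-negligible (\bigcup_n (S n `&` [set h : hist X A | (~` [set Delta]) (h n.+1).1])).
  apply: negligible_bigcup => n.
  exists (S n `&` [set h : hist X A | (~` [set Delta]) (h n.+1).1]).
  by split; [exact: mN|exact: N0|].
apply: negligibleS => h /=; apply: contra_notP => nN t ht s st hs; apply: ht.
rewrite -(subnKC st); elim: (t - s)%N => [|k IH]; first by rewrite addn0.
apply: contrapT => hk; apply: nN; exists (s + k)%N => //; split => //=.
by rewrite -addnS.
Qed.

(** The series is cut at [n]: early terms are at most [P (D (h t))], and a later visit to [YA Delta]
    at time [t] forces [tau > t] almost surely. *)
Lemma occupation_le n (D : set (borel X * borel A)%type) : measurable D ->
  (occupation Delta P D <=
   \sum_(0 <= t < n) P [set h : hist X A | D (h t)] + tail_time Delta P n)%E.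
Proof.
move=> mD; have mY := measurable_YA (A := A) oDelta.
have mc t B : measurable B -> measurable [set h : hist X A | B (h t)].
  by move=> mB; rewrite -[X in measurable X]setTI; exact: measurable_coordinate.
have m1 t : measurable_fun setT (fun h : hist X A => (\1_(D `&` YA Delta) (h t))%:E : \bar R).
  apply/measurable_EFinP; apply: (measurableT_comp _ (@measurable_coordinate X A t)).
  by apply: measurable_indic; exact: measurableI.
have m2 t : measurable_fun setT
    (fun h : hist X A => (((t%:R)%:E < tau R Delta h)%E)%:R%:E : \bar R).
  apply/measurable_EFinP.
  (* The event [tau > t] is a countable intersection of events on single coordinates, hence
     measurable. *)
  have -> : (fun h : hist X A => (((t%:R)%:E < tau R Delta h)%E)%:R : R) =
      \1_(\bigcap_(s in `I_t.+1) [set h : hist X A | YA Delta (h s)]).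
    apply/funext => h; rewrite indicE; congr ((nat_of_bool _)%:R).
    apply/idP/idP.
      by move=> /lt_tauP ht; rewrite inE => s /= /ht.
    by rewrite inE => ht; apply/lt_tauP => s st; exact: (ht s).
  by apply: measurable_indic; apply: bigcap_measurable => [|s _]; [exists 0%N|exact: mc].
have mD1 t : measurable_fun setT (fun h : hist X A => (\1_D (h t))%:E : \bar R).
  apply/measurable_EFinP; apply: (measurableT_comp _ (@measurable_coordinate X A t)).
  exact: measurable_indic.
have mtail : measurable_fun setT (fun h : hist X A =>
    \sum_(n <= t <oo) (((t%:R)%:E < tau R Delta h)%E)%:R%:E : \bar R)%E.
  by apply: ge0_emeasurable_tail => // t h; rewrite lee_fin.
have msum : measurable_fun setT (fun h : hist X A =>
    \sum_(0 <= t < n) (\1_D (h t))%:E : \bar R)%E.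
  exact: emeasurable_sum.
have -> : (\sum_(0 <= t < n) P [set h : hist X A | D (h t)] =
    \int[P]_h \sum_(0 <= t < n) (\1_D (h t))%:E)%E.
  rewrite ge0_integral_sum//; apply: eq_bigr => t _.
  by rewrite -[in LHS](setIT [set h | _]) -integral_indic//; exact: mc.
rewrite /tail_time -ge0_integralD//; last 2 first.
- by move=> h _; apply: sume_ge0 => t _; rewrite lee_fin.
- by move=> h _; apply: nneseries_ge0 => t _ _; rewrite lee_fin.
rewrite /occupation; apply: ae_ge0_le_integral => //.
- by move=> h _; apply: nneseries_ge0 => t _ _; rewrite lee_fin.
- by apply: ge0_emeasurable_tail => // t h; rewrite lee_fin.
- move=> h _; apply: adde_ge0; first by apply: sume_ge0 => t _; rewrite lee_fin.
  by apply: nneseries_ge0 => t _ _; rewrite lee_fin.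
- exact: emeasurable_funD.
have := state_absorbed; apply: filterS => h habs _.
rewrite (nneseries_split 0 n); last by move=> t _; rewrite lee_fin.
rewrite add0n; apply: leeD.
  apply: lee_sum => t _; rewrite lee_fin !indicE ler_nat.
  by rewrite in_setI; case: (_ \in D) => //=; rewrite leq_b1.
apply: lee_nneseries => t; first by rewrite lee_fin.
move=> _; rewrite lee_fin indicE ler_nat.
have [|//] := boolP (h t \in _); rewrite inE => -[_ /habs ht].
by rewrite (iffRL (lt_tauP R Delta t h)).
Qed.

End strategic_measure.

(** * Uniform bounds over strategies and initial states *)

Lemma near_forall_finite (T : choiceType) (F : set T) (Q : T -> nat -> Prop) :
  finite_set F -> (forall x, F x -> \forall k \near \oo, Q x k) ->
  \forall k \near \oo, forall x, F x -> Q x k.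
Proof.
move=> /finite_seqP[s ->]; elim: s => [|y s IH] H.
  by apply: nearW => k x.
have Hs : forall x, x \in s -> \forall k \near \oo, Q x k.
  by move=> x xs; apply: H; rewrite /= in_cons xs orbT.
have Hy : \forall k \near \oo, Q y k by apply: H; rewrite /= in_cons eqxx.
move: Hy (IH Hs); apply: filterS2 => k Qy Qs x; rewrite /= in_cons => /predU1P[->//|].
exact: Qs.
Qed.

Section uniform_occupation.
Context (R : realType) (X A : ptopologicalType) (Delta : X).
Variable p : (borel X * borel A)%type -> probability (borel X) R.
Variable Pm : X -> strategy R X A -> probability (hist X A) R.
Variable F : set X.
Hypothesis kp : is_kernel p.
Hypothesis condS : condition_S p.
Hypothesis closed_points : forall x : X, closed [set x].
Hypothesis oDelta : open [set Delta].
Hypothesis absorbing : forall a : A, p (Delta, a) [set Delta] = 1%E.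
Hypothesis smP : forall x pi, is_strategy pi -> is_strategic_measure p x pi (Pm x pi).
Hypothesis finF : finite_set F.
Hypothesis uaF : forall x, F x -> uniformly_absorbing Delta Pm x.

Definition occupation_measures : set {measure set (borel X * borel A)%type -> \bar R} :=
  [set mu | exists x pi, [/\ F x, is_strategy pi & mu = occupation_measure (Pm x pi) oDelta]].

Lemma tail_time_small x eps : F x -> 0 < eps ->
  exists n, forall pi, is_strategy pi -> (tail_time Delta (Pm x pi) n <= eps%:E)%E.
Proof.
move=> Fx e0; have [_ /fine_cvgP[fin /cvgrPdist_le/(_ _ e0) le]] := uaF Fx.
have [n _ /(_ _ (leqnn n))[finn len]] := filterI fin le.
exists n => pi spi; apply: (@le_trans _ _ (ereal_sup
  [set tail_time Delta (Pm x pi) n | pi in @is_strategy R X A])).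
  by apply: ereal_sup_ubound; exists pi.
by rewrite -[leLHS]fineK// lee_fin; move: len; rewrite sub0r normrN ler_norml => /andP[].
Qed.

Lemma occupation_measures_bounded : exists2 C, 0 <= C &
  forall mu, occupation_measures mu -> (mu setT <= C%:E)%E.
Proof.
have : \forall k \near \oo, forall x, F x ->
    forall pi, is_strategy pi -> (occupation Delta (Pm x pi) setT <= k%:R%:E)%E.
  apply: near_forall_finite => // x Fx.
  have [n ntail] := tail_time_small Fx ltr01.
  (* The first [n] times contribute mass at most [n], and the tail at most [1]. *)
  exists n.+1 => // k /= nk pi spi.
  apply: le_trans (occupation_le (smP x spi) oDelta absorbing n measurableT) _.
  apply: (@le_trans _ _ (n%:R%:E + 1%:E)%E).
    apply: leeD; last exact: ntail.
    apply: (@le_trans _ _ (\sum_(0 <= t < n) 1%:E)%E).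
      apply: lee_sum => t _; apply: probability_le1.
      by rewrite -[X in measurable X]setTI; exact: measurable_coordinate.
    by rewrite sumEFin sumr_const_nat subn0.
  by rewrite -EFinD lee_fin natr1 ler_nat.
case=> k _ /(_ _ (leqnn k)) kP; exists k%:R => // mu [x [pi [Fx spi ->]]].
exact: kP.
Qed.

(** Uniform absorption first fixes a horizon [n] with tails below [eps / 2]; the finitely many terms
    before [n] are bounded by iterates of the maximal operator, which vanish as [k] grows. *)
Lemma occupation_measures_vanishing (q : nat -> A) :
  (forall f : A -> R, continuous f ->
    forall M, (forall n, f (q n) <= M) -> forall a, f a <= M) ->
  uniformly_vanishing occupation_measures.
Proof.
move=> qdense B mB B0 eps e0.
have e20 : 0 < eps / 2 by rewrite divr_gt0.
(* The operator preserves decreasing sequences, so [B k] is enlarged to a set decreasing to the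
   empty set. *)
pose B' k := \bigcup_(j >= k) B j.
have mB' k : measurable (B' k) by apply: bigcup_measurable.
have vB : vanishing_seq (fun k => \1_(B' k) : borel X -> R).
  split=> [k|y|y].
  - exact: unit_fun_indic.
  - move=> m n mn; rewrite !indicE ler_nat.
    have [|//] := boolP (y \in B' n); rewrite inE => -[j /= nj Bj].
    by rewrite mem_set//; exists j => //=; exact: leq_trans nj.
  - apply: cvg_near_cst; have [N _ NB] := B0 y.
    exists N => // k /= Nk; rewrite indicE memNset// => -[j /= kj].
    by apply: NB; exact: leq_trans kj.
have vT t : vanishing_seq (fun k => iter t (max_transition p q) (\1_(B' k))).
  by elim: t => //= t IH; exact: vanishing_max_transition.
have : \forall k \near \oo, forall x, F x -> forall pi, is_strategy pi ->
    (occupation Delta (Pm x pi) (B k `*` setT) <= eps%:E)%E.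
  apply: near_forall_finite => // x Fx.
  have [n ntail] := tail_time_small Fx e20.
  have : (fun k => \sum_(0 <= t < n) iter t (max_transition p q) (\1_(B' k)) x) @ \oo
      --> (\sum_(0 <= t < n) 0 : R).
    by apply: cvg_big => [|t _]; [exact: add_continuous|have [_ _] := vT t; exact].
  rewrite big1// => /cvgrPdist_le/(_ _ e20); apply: filterS => k.
  rewrite sub0r normrN => /(le_trans (ler_norm _)) kn pi spi.
  have mBk : measurable (B k `*` [set: borel A]) by exact: measurableX.
  apply: le_trans (occupation_le (smP x spi) oDelta absorbing n mBk) _.
  rewrite (splitr eps) EFinD; apply: leeD; last exact: ntail.
  apply: (@le_trans _ _ (\sum_(0 <= t < n) (iter t (max_transition p q) (\1_(B' k)) x)%:E)%E).
    apply: lee_sum => t _.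
    apply: le_trans (prob_state_le kp (smP x spi) condS (@closed_points x) qdense t (mB' k)).
    apply: le_measure; rewrite ?inE.
    - by rewrite -[X in measurable X]setTI; exact: measurable_coordinate.
    - by rewrite -[X in measurable X]setTI; exact: measurable_state.
    - by move=> h [Bh _]; exists k => //=.
  by rewrite sumEFin lee_fin.
case=> k _ /(_ _ (leqnn k)) kP; exists k; split=> // mu [x [pi [Fx spi ->]]].
exact: kP.
Qed.

End uniform_occupation.

(** * Comparison of the two topologies *)

Lemma patch_clopen_continuous (R : realType) (T : topologicalType) (U : set T)
    (g : T -> R) :
  open U -> closed U -> {within U, continuous g} ->
  continuous (fun z => if z \in U then g z else 0).
Proof.
move=> oU /closed_openC oUC; rewrite continuous_open_subspace// => cg z.
have [zU|zU] := boolP (z \in U).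
  have nU : \forall y \near z, U y by apply: open_nbhs_nbhs; split=> //; rewrite inE in zU.
  rewrite /continuous_at zU; have := cg z zU; rewrite /continuous_at.
  apply: cvg_trans; apply: near_eq_cvg; apply: filterS nU => y Uy.
  by rewrite mem_set.
have nU : \forall y \near z, (~` U) y.
  by apply: open_nbhs_nbhs; split=> //; rewrite notin_setE in zU.
rewrite /continuous_at (negbTE zU); apply: cvg_near_cst.
by apply: filterS nU => y Uy; rewrite memNset.
Qed.

(** The interpolants are finite sums of products of measurable functions of one variable and
    converge pointwise to [g]. This gives measurability for the product sigma-algebra, in particular
    when [g] is jointly continuous. *)
Lemma caratheodory_measurable (R : realType) (X A : ptopologicalType)
    (Q : pseudoMetricType R) (e : A -> Q) (g : (borel X * borel A)%type -> R) :
  metric_embedding e -> compact [set: A] ->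
  (forall a, measurable_fun setT (fun y : borel X => g (y, a))) ->
  (forall y, continuous (fun a : borel A => g (y, a))) -> measurable_fun setT g.
Proof.
move=> me cA mg cg.
have [s [phi [cphi phi0 phi1 interp]]] := compact_interpolation me cA.
apply: (@measurable_fun_cvg _ _ _ _
  (fun k (z : borel X * borel A) => \sum_(c <- s k) g (z.1, c) * phi k c z.2)).
  move=> k; apply: measurable_sum => c; apply: measurable_funM.
    exact: (measurableT_comp (mg c) measurable_fst).
  have mphi : measurable_fun setT (phi k c : borel A -> R).
    by apply: borel_continuous_measurable; exact: cphi.
  exact: (measurableT_comp mphi measurable_snd).
move=> [y a] _; apply/cvgrPdist_le => /= eps e0.
have := interp _ (cg y) _ e0; apply: filterS => k; exact.
Qed.

(** A uniform limit of continuous functions is continuous, in terms of generated topologies. *)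
Lemma initial_topology_approx (R : realType) (T : Type) (D : set T)
    (maps1 maps2 : set (T -> R)) :
  (forall phi, maps1 phi -> forall eps, 0 < eps -> exists2 psi, maps2 psi &
    forall t, D t -> `|phi t - psi t| <= eps) ->
  initial_topology_on D maps1 `<=` initial_topology_on D maps2.
Proof.
move=> H U hU O tO sO; apply: hU => // _ [phi [V [m1 [oV ->]]]].
have [_ Obig _] := tO.
(* A subbasic set of the first topology is the union of the [O]-open sets inside it, so a
   neighbourhood of each of its points suffices. *)
rewrite (_ : [set t | _] = \bigcup_(W in [set W | O W /\
    W `<=` [set t | D t /\ V (phi t)]]) W).
  by apply: Obig => W [].
apply/seteqP; split=> [t [Dt Vt]|t [W [_ WU] Wt]]; last exact: WU.
have /nbhs_ballP[r /= r0 rV] : nbhs (phi t) V by exact: open_nbhs_nbhs.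
(* Two approximation errors and the radius of the [psi]-ball add up to less than [r]. *)
have r40 : 0 < r / 4 by rewrite divr_gt0.
have [psi m2 close] := H _ m1 _ r40.
exists [set s | D s /\ ball (psi t) (r / 4) (psi s)]; last first.
  by split=> //; exact: ballxx.
split; first by apply: sO; exists psi, (ball (psi t) (r / 4)); split=> //; split=> //; exact: ball_open.
move=> s [Ds ts]; split=> //; apply: rV.
have := close _ Dt; have := close _ Ds; move: ts; rewrite -!ball_normE/= => ts cs ct.
apply: le_lt_trans (ler_distD (psi t) _ _) _.
apply: le_lt_trans (lerD (lexx _) (ler_distD (psi s) _ _)) _.
by rewrite (distrC (psi s)); lra.
Qed.

(** Turns the approximation of the zero extension of [f] on the whole space into closeness of the
    integrals over [D]. *)
Lemma Rintegral_dist_le (R : realType) (d : measure_display) (T : measurableType d)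
    (mu : {measure set T -> \bar R}) (D : set T) (f g : T -> R) (K eps : R) :
  measurable D -> (mu setT < +oo)%E -> measurable_fun D f -> measurable_fun setT g ->
  (forall z, D z -> `|f z| <= K) -> (forall z, `|g z| <= K) ->
  (\int[mu]_z `|(if z \in D then f z else 0) - g z|%:E <= eps%:E)%E ->
  `|Rintegral mu D f - Rintegral mu D g| <= eps.
Proof.
move=> mD muT mf mg fK gK.
have muD : (mu D < +oo)%E by apply: le_lt_trans muT; apply: le_measure; rewrite ?inE.
have mgD : measurable_fun D g by exact: measurable_funTS.
have bnd (h : T -> R) : (forall z, D z -> `|h z| <= K) -> [bounded h z | z in D].
  move=> hK; exists K; split; first exact: num_real.
  by move=> M KM z Dz; apply: le_trans (hK z Dz) (ltW KM).
have intf : mu.-integrable D (EFin \o f) by apply: measurable_bounded_integrable => //; exact: bnd.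
have intg : mu.-integrable D (EFin \o g).
  by apply: measurable_bounded_integrable => //; apply: bnd => z _; exact: gK.
move=> le_eps; rewrite -RintegralB//.
have intB : mu.-integrable D (EFin \o (fun z => f z - g z)).
  rewrite (_ : _ \o _ = (EFin \o f) \- (EFin \o g))%E; first exact: integrableB.
  by apply/funext => z; rewrite /= EFinB.
apply: le_trans (le_normr_Rintegral mD intB) _.
have fin : (\int[mu]_(z in D) (`|f z - g z|)%:E)%E \is a fin_num.
  by apply: integrable_fin_num => //; exact: integrable_norm intB.
rewrite /Rintegral -lee_fin fineK//; apply: le_trans le_eps.
have -> : (\int[mu]_(z in D) (`|f z - g z|)%:E =
    \int[mu]_(z in D) (`|(if z \in D then f z else 0) - g z|)%:E)%E.
  by apply: eq_integral => z ->.
apply: ge0_subset_integral => //.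
apply/measurable_EFinP; apply: measurableT_comp => //; apply: measurable_funB => //.
by have := (measurable_restrictT f mD).1 mf.
Qed.

Theorem theorem1 (R : realType) (X A : ptopologicalType) (Delta : X)
    (p : (borel X * borel A)%type -> probability (borel X) R)
    (Pm : X -> strategy R X A -> probability (hist X A) R)
    (F : set X) :
  (* model {Y u {Delta}, A, p}: Borel spaces, Delta an isolated point *)
  is_Borel_space R (setT : set X) ->
  is_Borel_space R (~` [set Delta]) ->
  is_Borel_space R (setT : set A) ->
  open [set Delta] -> closed [set Delta] ->
  is_kernel p ->
  (forall a : A, p (Delta, a) [set Delta] = 1%E) ->
  (* Condition (S) *)
  condition_S p ->
  (* Pm x pi is the strategic measure P^pi_x *)
  (forall x pi, is_strategy pi -> is_strategic_measure p x pi (Pm x pi)) ->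
  (* F nonempty finite, uniformly absorbing from every x in F *)
  finite_set F -> F !=set0 ->
  (forall x, F x -> uniformly_absorbing Delta Pm x) ->
  w_topology Delta Pm F = ws_topology Delta Pm F.
Proof.
move=> BX _ BA oD cD kp absD condS smP finF _ uaF.
have [PX [eX meX]] := Borel_space_embedding BX.
have [PA [eA meA]] := Borel_space_embedding BA.
have cA := condS.1.
have [s [phi [_ phi0 phi1 interp]]] := compact_interpolation meA cA.
have [q qdense] := interpolation_dense_seq phi0 phi1 interp.
have closed_points (x : X) : closed [set x] by exact: Borel_space_closed_set1 BX.
have vanish := occupation_measures_vanishing kp condS closed_points oD absD smP
  finF uaF qdense.
have [C C0 massC] := occupation_measures_bounded oD absD smP finF uaF.
have mY := measurable_YA (A := A) oD.
have oY : open (YA Delta : set (borel X * borel A)).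
  apply: (@open_comp _ _ fst (~` [set Delta])); last exact: closed_openC.
  by move=> z _; exact: cvg_fst.
have cY : closed (YA Delta : set (borel X * borel A)).
  apply: (@closed_comp _ _ fst (~` [set Delta])); last exact: open_closedC.
  by move=> z _; exact: cvg_fst.
apply/seteqP; split; apply: initial_topology_approx.
  (* A bounded continuous [g] is itself a test function for the ws-topology; what has to be checked
     is its measurability for the product sigma-algebra. *)
  move=> _ [g [[bg cg] ->]] eps e0; exists (integ_YA Delta g); last first.
    by move=> eta _; rewrite subrr normr0 ltW.
  exists g; split=> //.
  pose G z := if z \in YA Delta then g z else 0.
  have cG : continuous G by exact: patch_clopen_continuous.
  have cGl y : continuous (fun a : borel A => G (y, a)).
    move=> a; apply: (@continuous_comp _ _ _ (fun a => (y, a)) G); last exact: cG.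
    by apply: cvg_pair; [exact: cvg_cst|exact: cvg_id].
  have mG : measurable_fun setT G.
    apply: (caratheodory_measurable meA cA) => // a.
    apply: borel_continuous_measurable => y.
    apply: (@continuous_comp _ _ _ (fun y => (y, a)) G); last exact: cG.
    by apply: cvg_pair; [exact: cvg_id|exact: cvg_cst].
  split=> //.
    apply: (eq_measurable_fun G); last exact: measurable_funTS.
    by move=> z zY; rewrite /G zY.
  move=> y yD; rewrite (_ : (fun a => g (y, a)) = (fun a => G (y, a)))//.
  by apply/funext => a; rewrite /G mem_set.
(* Conversely, [g] is extended by zero across [Delta], which keeps it a bounded Caratheodory
   function, and approximated there by a continuous [H]. *)
move=> _ [g [[[K0 gK0] mg cg] ->]] eps e0.
(* The maximum with [0] makes [K] bound the zero extension even if [YA Delta] is empty and [K0]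
   negative. *)
pose K := Num.max 0 K0.
have gK z : YA Delta z -> `|g z| <= K by move=> /gK0 /le_trans; apply; rewrite le_max lexx orbT.
pose G z := if z \in YA Delta then g z else 0.
have mG : measurable_fun setT G by exact: (measurable_restrictT g mY).1.
have GK z : `|G z| <= K.
  rewrite /G; case: ifPn => [|_]; first by rewrite inE => /gK.
  by rewrite normr0 le_max lexx.
have cG y : continuous (fun a : borel A => G (y, a)).
  have [->|/eqP yD] := eqVneq y Delta.
    rewrite (_ : (fun a => G (Delta, a)) = cst 0); first by move=> a; exact: cvg_cst.
    by apply/funext => a; rewrite /G memNset// => /(_ erefl).
  rewrite (_ : (fun a => G (y, a)) = (fun a => g (y, a))); first exact: cg.
  by apply/funext => a; rewrite /G mem_set.
have [H [cH mH HK Heps]] := caratheodory_uniform_approximation vanish meX meA cA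
  C0 massC mG GK cG e0.
exists (integ_YA Delta H).
  exists H; split=> //; split; first by exists K => z _; exact: HK.
  exact: continuous_subspaceT.
move=> _ [x [pi [Fx spi ->]]].
have Mmu : occupation_measures Pm F oD (occupation_measure (Pm x pi) oD) by exists x, pi.
apply: (@Rintegral_dist_le _ _ _ (occupation_measure (Pm x pi) oD) (YA Delta) g H K eps) => //.
  exact: le_lt_trans (massC _ Mmu) (ltry _).
exact: Heps.
Qed.
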